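(* For each countable ordered set $C$ there is a locally solvable subgroup $W_C$ of Thompson's group $F$ and a pure tower $T$ in $W_C$, order isomorphic to $C$, whose signatures generate $W_C$. Furthermore, for each $n\in\mathbb{N}$, any set of $n$ distinct signatures of the generating tower $T$ generates a subgroup isomorphic to $W_n$.
   Context: ''Ordered set'' means totally ordered set. $I=[0,1]$. $\mathrm{PL}_o(I)$ is the group, under composition, of piecewise linear orientation-preserving homeomorphisms of $I$ with finitely many breakpoints. Thompson's group $F$ is the subgroup of elements whose breakpoints are dyadic rationals and whose slopes are integral powers of $2$. A group is locally solvable if every finitely generated subgroup of it is solvable. For $n\in\mathbb{N}$, the groups $W_n$ are defined by $W_0=1$ and $W_n=W_{n-1}\wr\mathbb{Z}$, where $A\wr B=\left(\bigoplus_{b\in B}A\right)\rtimes B$ is the standard restricted wreath product, $B$ acting on the index set by right multiplication. An orbital of $f\in \mathrm{PL}_o(I)$ is a maximal (open) interval contained in $\mathrm{Supp}(f)=\{x\in I : (x)f\neq x\}$. A signed orbital is a pair $(A,f)$ with $A$ an orbital of $f$; $f$ is called its signature. A tower in a subgroup $G$ of $\mathrm{PL}_o(I)$ is a set $T$ of signed orbitals with signatures in $G$ such that the orbitals occurring in $T$ form a chain under inclusion and each of these orbitals is assigned exactly one signature; $T$ is totally ordered by inclusion of orbitals. A tower is pure if each of its signatures has exactly one orbital. *)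

(* Defs.v *)
From HB Require Import structures.
From mathcomp Require Import all_boot all_order all_algebra.
From mathcomp Require Import all_classical all_reals all_analysis.

Set Implicit Arguments.
Unset Strict Implicit.
Unset Printing Implicit Defensive.

Import Order.TTheory GRing.Theory Num.Theory numFieldNormedType.Exports.
Import Algebra.

Local Open Scope classical_set_scope.
Local Open Scope ring_scope.

Section Groups.
Context {G : groupType}.
Implicit Types (X H : set G).

Definition is_subgroup H : Prop := group_closed (mem H).

Definition generated X : set G := smallest is_subgroup X.

Definition derived_subgroup H : set G :=
  generated [set [~ x, y]%g | x in H & y in H].

Definition solvable_subgroup H : Prop :=
  exists n : nat, iter n derived_subgroup H = [set 1%g].

Definition locally_solvable H : Prop :=
  forall X, finite_set X -> X `<=` H -> solvable_subgroup (generated X).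

Definition isomorphic_to H (K : groupType) : Prop :=
  exists phi : {multiplicative K -> G}, injective phi /\ range phi = H.

End Groups.

(* The pair (f, b) stands for the element f * b of the semidirect product.
   Right multiplication by b moves the coordinate x to x * b, that is
   (f ^ b) (x * b) = f x; hence b * g * b^-1 is the map x |-> g (x * b).     *)
Record wreath (A B : groupType) := Wreath {
  wbase : B -> A;
  wtop : B;
  wbase_finite : finite_set [set x | wbase x != 1%g] }.

Section Wreath.
Variables A B : groupType.
Implicit Types u v w : wreath A B.

HB.instance Definition _ := gen_eqMixin (wreath A B).
HB.instance Definition _ := gen_choiceMixin (wreath A B).

Lemma wreath_eq u v :
  wbase u =1 wbase v -> wtop u = wtop v -> u = v.
Proof.
case: u v => [f b Hf] [g c Hg] /= /funext fg bc.
by move: Hf Hg; rewrite fg bc => Hf Hg; congr Wreath; exact: Prop_irrelevance.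
Qed.

Lemma wone_finite : finite_set [set x : B | (1%g : A) != 1%g].
Proof. by apply: (sub_finite_set _ (finite_set0 B)) => x /=; rewrite eqxx. Qed.

Definition wone : wreath A B := Wreath 1%g wone_finite.

Lemma wshift_finite (f : B -> A) (b : B) :
  finite_set [set x | f x != 1%g] -> finite_set [set x | f (x * b)%g != 1%g].
Proof.
move=> ff; apply: (sub_finite_set _ (finite_image (fun y => y / b)%g ff)).
by move=> x /= fx; exists (x * b)%g => //; rewrite mulgK.
Qed.

Lemma wmul_finite u v :
  finite_set [set x | (wbase u x * wbase v (x * wtop u))%g != 1%g].
Proof.
have fv := wshift_finite (wtop u) (wbase_finite v).
have uv : finite_set ([set x | wbase u x != 1%g] `|`
                      [set x | wbase v (x * wtop u)%g != 1%g]).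
  by rewrite finite_setU; split => //; exact: wbase_finite.
apply: (sub_finite_set _ uv) => {uv} x /= uv; case: (eqVneq (wbase u x) 1%g) => [ux|]; last by left.
by right; move: uv; rewrite ux mul1g.
Qed.

Definition wmul u v : wreath A B := Wreath (wtop u * wtop v)%g (wmul_finite u v).

Lemma winv_finite u :
  finite_set [set x | ((wbase u (x * (wtop u)^-1))^-1)%g != 1%g].
Proof.
apply: (sub_finite_set _ (wshift_finite (wtop u)^-1%g (wbase_finite u))).
by move=> x /=; apply: contraNN => /eqP ->; rewrite invg1.
Qed.

Definition winv u : wreath A B := Wreath (wtop u)^-1%g (winv_finite u).

Lemma wmulA : associative wmul.
Proof. by move=> u v w; apply: wreath_eq => [x|] /=; rewrite !mulgA. Qed.

Lemma wmul1g : left_id wone wmul.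
Proof. by move=> u; apply: wreath_eq => [x|] /=; rewrite ?mulg1 mul1g. Qed.

Lemma wmulg1 : right_id wone wmul.
Proof. by move=> u; apply: wreath_eq => [x|] /=; rewrite mulg1. Qed.

Lemma wmulVg : left_inverse wone winv wmul.
Proof. by move=> u; apply: wreath_eq => [x|] /=; rewrite mulVg. Qed.

Lemma wmulgV : right_inverse wone winv wmul.
Proof.
by move=> u; apply: wreath_eq => [x|] /=; rewrite ?mulgK mulgV.
Qed.

HB.instance Definition _ :=
  isGroup.Build (wreath A B) wmulA wmul1g wmulg1 wmulVg wmulgV.

End Wreath.

Section UnitGroup.

Definition umul (_ _ : unit) : unit := tt.
Definition uinv (_ : unit) : unit := tt.

Lemma umulA : associative umul. Proof. by []. Qed.
Lemma umul1g : left_id tt umul. Proof. by case. Qed.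
Lemma umulg1 : right_id tt umul. Proof. by case. Qed.
Lemma umulVg : left_inverse tt uinv umul. Proof. by []. Qed.
Lemma umulgV : right_inverse tt uinv umul. Proof. by []. Qed.

HB.instance Definition _ :=
  isGroup.Build unit umulA umul1g umulg1 umulVg umulgV.

End UnitGroup.

Fixpoint W (n : nat) : groupType :=
  if n is n'.+1 then wreath (W n') (to_multiplicative int) else unit.

Section PL.
Context {R : realType}.

Definition unitI : Type := set_type (`[0, 1]%classic : set R).

HB.instance Definition _ := Topological.on unitI.

Implicit Types (f : unitI -> unitI) (x y a b : unitI) (m : R).

Definition affine_on f a b m : Prop :=
  exists c : R, forall x, \val a <= \val x <= \val b ->
    \val (f x) = m * \val x + c.

Definition piecewise_linear f : Prop :=
  exists2 S : set unitI, finite_set S &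
    forall a b, (forall s, S s -> ~ (\val a < \val s < \val b)) ->
      exists m, affine_on f a b m.

Definition breakpoint f x : Prop :=
  0 < \val x < 1 /\
  ~ exists a b m, \val a < \val x < \val b /\ affine_on f a b m.

Definition slope f m : Prop :=
  exists a b, \val a < \val b /\ affine_on f a b m.

Definition homeomorphism f : Prop :=
  continuous f /\
  exists g : unitI -> unitI, [/\ cancel f g, cancel g f & continuous g].

Definition is_PLo f : Prop :=
  [/\ homeomorphism f, {homo f : x y / \val x < \val y} & piecewise_linear f].

End PL.
Arguments unitI R : clear implicits.

Record PLo (R : realType) := MkPLo {
  PLo_fun :> unitI R -> unitI R;
  PLo_prop : is_PLo PLo_fun }.

Section PLoGroup.
Context {R : realType}.
Implicit Types (f g h : PLo R).

HB.instance Definition _ := gen_eqMixin (PLo R).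
HB.instance Definition _ := gen_choiceMixin (PLo R).

Lemma PLo_eq f g : f =1 g -> f = g.
Proof.
case: f g => [f Hf] [g Hg] /= /funext fg.
by move: Hf Hg; rewrite fg => Hf Hg; congr MkPLo; exact: Prop_irrelevance.
Qed.

Lemma is_PLo_id : is_PLo (@idfun (unitI R)).
Proof.
split => //.
  by split; [move=> x; exact: cvg_id|exists idfun; split => // x; exact: cvg_id].
exists set0 => // a b _; exists 1, 0 => x _.
by rewrite mul1r addr0.
Qed.

Lemma homo_PLo_le f (x y : unitI R) : \val x <= \val y -> \val (f x) <= \val (f y).
Proof.
have [_ fh _] := PLo_prop f.
rewrite le_eqVlt => /orP[/eqP /val_inj -> //|xy].
by apply: ltW; exact: fh.
Qed.

Lemma is_PLo_comp f g : is_PLo (g \o f).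
Proof.
have [[fc [f' [fK f'K f'c]]] fh [S Sfin Sf]] := PLo_prop f.
have [[gc [g' [gK g'K g'c]]] gh [S' S'fin S'g]] := PLo_prop g.
split.
- split; first by move=> x; apply: continuous_comp; [exact: fc|exact: gc].
  exists (f' \o g'); split; [exact: can_comp|exact: can_comp|].
  by move=> x; apply: continuous_comp; [exact: g'c|exact: f'c].
- by move=> x y /fh/gh.
exists (S `|` f' @` S').
  by rewrite finite_setU; split => //; exact: finite_image.
move=> a b Sab.
have [m [c fE]] : exists m, affine_on f a b m.
  by apply: Sf => s Ss; apply: Sab; left.
have [m' [c' gE]] : exists m', affine_on g (f a) (f b) m'.
  apply: S'g => s Ss /andP[as_ sb]; apply: (Sab (f' s)); first by right; exists s.
  apply/andP; split; rewrite ltNge; apply/negP => /(homo_PLo_le f).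
    by rewrite f'K leNgt as_.
  by rewrite f'K leNgt sb.
exists (m' * m), (m' * c + c') => x axb /=.
rewrite gE; first by rewrite fE // mulrDr mulrA addrA.
by case/andP: axb => ax xb; apply/andP; split; exact: homo_PLo_le.
Qed.

Lemma is_PLo_inv f : exists g : PLo R, cancel f g /\ cancel g f.
Proof.
have [[fc [f' [fK f'K f'c]]] fh [S Sfin Sf]] := PLo_prop f.
have f'h : {homo f' : x y / \val x < \val y}.
  move=> x y xy; rewrite ltNge; apply/negP => /(homo_PLo_le f).
  by rewrite !f'K leNgt xy.
have f'le (x y : unitI R) : \val x <= \val y -> \val (f' x) <= \val (f' y).
  by rewrite le_eqVlt => /orP[/eqP /val_inj -> //|/f'h/ltW].
suff f'P : is_PLo f' by exists (MkPLo f'P).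
split => //; first by split => //; exists f.
exists (f @` S); first exact: finite_image.
move=> a b Sab.
have [ab|ba] := ltP (\val a) (\val b); last first.
  exists 0, (\val (f' a)) => x /andP[ax xb].
  have -> : x = a by apply: val_inj; apply/le_anti; rewrite ax (le_trans xb ba).
  by rewrite mul0r add0r.
have [m [c fE]] : exists m, affine_on f (f' a) (f' b) m.
  apply: Sf => s Ss /andP[/fh + /fh]; rewrite !f'K => as_ sb.
  by apply: (Sab (f s)); [exists s|rewrite as_ sb].
have m0 : m != 0.
  have ab' : \val (f' a) <= \val (f' b) by apply: f'le; exact: ltW.
  apply: contraTneq ab => m0.
  have := fE (f' a); rewrite lexx ab' f'K m0 mul0r add0r => /(_ isT) ->.
  have := fE (f' b); rewrite lexx ab' f'K m0 mul0r add0r => /(_ isT) ->.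
  by rewrite ltxx.
exists m^-1, (- (m^-1 * c)) => x /andP[ax xb].
have := fE (f' x); rewrite f'K !f'le // => -> //.
by rewrite mulrDr mulrA mulVf // mul1r addrK.
Qed.

(* Elements of the group act on the right: (x)(f * g) = ((x)f)g. *)
Definition PLo_one : PLo R := MkPLo is_PLo_id.
Definition PLo_mul f g : PLo R := MkPLo (is_PLo_comp f g).
Definition PLo_inv f : PLo R := sval (cid (is_PLo_inv f)).

Lemma PLo_mulA : associative PLo_mul.
Proof. by move=> f g h; apply: PLo_eq. Qed.

Lemma PLo_mul1g : left_id PLo_one PLo_mul.
Proof. by move=> f; apply: PLo_eq. Qed.

Lemma PLo_mulg1 : right_id PLo_one PLo_mul.
Proof. by move=> f; apply: PLo_eq. Qed.

Lemma PLo_mulVg : left_inverse PLo_one PLo_inv PLo_mul.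
Proof.
by move=> f; apply: PLo_eq => x; rewrite /PLo_inv; case: cid => g [] /=.
Qed.

Lemma PLo_mulgV : right_inverse PLo_one PLo_inv PLo_mul.
Proof.
by move=> f; apply: PLo_eq => x; rewrite /PLo_inv; case: cid => g [] /=.
Qed.

HB.instance Definition _ :=
  isGroup.Build (PLo R) PLo_mulA PLo_mul1g PLo_mulg1 PLo_mulVg PLo_mulgV.

End PLoGroup.

Section Towers.
Context {R : realType}.
Implicit Types (f : PLo R) (A B : set (unitI R)).

Definition dyadic (x : R) : Prop := exists (z : int) (n : nat), x = z%:~R / 2 ^+ n.

Definition thompsonF : set (PLo R) :=
  [set f | (forall x, breakpoint f x -> dyadic (\val x)) /\
           (forall m, slope f m -> exists k : int, m = 2 ^ k)].

Definition support f : set (unitI R) := [set x | f x <> x].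

(* Every element fixes both ends of I, so an open interval contained in a
   support is always of this form, with a and b in I.                         *)
Definition open_interval A : Prop :=
  exists a b : unitI R, \val a < \val b /\ A = [set x | \val a < \val x < \val b].

Definition orbital f A : Prop :=
  [/\ open_interval A, A `<=` support f &
      forall B, open_interval B -> A `<=` B -> B `<=` support f -> B = A].

Definition signed_orbital : Type := (set (unitI R) * PLo R)%type.

Definition signatures (T : set signed_orbital) : set (PLo R) := snd @` T.

Definition tower (G : set (PLo R)) (T : set signed_orbital) : Prop :=
  [/\ forall p, T p -> orbital p.2 p.1 /\ G p.2,
      forall p q, T p -> T q -> p.1 `<=` q.1 \/ q.1 `<=` p.1 &
      forall p q, T p -> T q -> p.1 = q.1 -> p.2 = q.2].

Definition pure (T : set signed_orbital) : Prop :=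
  forall p, T p -> exists! A, orbital p.2 A.

Definition tower_order_isomorphic (T : set signed_orbital)
    (d : Order.disp_t) (C : orderType d) : Prop :=
  exists2 phi : C -> signed_orbital, set_bij [set: C] T phi &
    forall c c' : C, (c <= c')%O <-> (phi c).1 `<=` (phi c').1.

End Towers.
Arguments thompsonF R : clear implicits.
Arguments signed_orbital R : clear implicits.

(* Main.v *)
(* Embed C in the dyadic gaps 0 < p_c < q_c < 1/2 with q_c < p_c' for c < c',
   and let f_c be a one-bump element of F with support
   A_c = (1/2 - q_c, 1/2 + q_c) that moves 1/2 - p_c beyond 1/2 + p_c. Then
   every A_c with c < c' lies in S_c' = (1/2 - p_c', 1/2 + p_c'), whose
   translates under the powers of f_c' are pairwise disjoint. Hence if
   c_1 < ... < c_n < c, the group generated by f_{c_1}, ..., f_{c_n}, f_c is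
   the wreath product of the one generated by f_{c_1}, ..., f_{c_n} with Z, and
   induction gives W_n. Each W_n is solvable, and a finitely generated subgroup
   of W_C involves only finitely many of the f_c. *)
From HB Require Import structures.
Require Import Defs.
From mathcomp Require Import all_boot all_order all_algebra.
From mathcomp Require Import all_classical all_reals all_analysis.
From mathcomp Require finmap.
From mathcomp Require Import lra.

Set Implicit Arguments.
Unset Strict Implicit.
Unset Printing Implicit Defensive.

Import Order.TTheory GRing.Theory Num.Theory numFieldNormedType.Exports.

Local Open Scope classical_set_scope.
Local Open Scope ring_scope.

(** * Generated subgroups, finite generation and solvability *)

Section Subgroups.
Context {G : groupType}.
Implicit Types (X Y H : set G) (x y : G).

Lemma is_subgroupP H :
  is_subgroup H <-> H 1%g /\ forall x y, H x -> H y -> H (x / y)%g.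
Proof.
split=> [[H1 HB]|[H1 HB]].
  by split=> [|x y /mem_set Hx /mem_set Hy]; [exact: set_mem|exact/set_mem/HB].
by split=> [|x y /set_mem Hx /set_mem Hy]; [exact/mem_set|exact/mem_set/HB].
Qed.

Lemma subgroup1 H : is_subgroup H -> H 1%g.
Proof. by case/is_subgroupP. Qed.

Lemma subgroupV H x : is_subgroup H -> H x -> H (x^-1)%g.
Proof. by case/is_subgroupP => H1 HB Hx; rewrite -div1g; exact: HB. Qed.

Lemma subgroupM H x y : is_subgroup H -> H x -> H y -> H (x * y)%g.
Proof.
move=> sH Hx Hy; rewrite -[y]invgK.
by case/is_subgroupP: (sH) => _; apply => //; exact: subgroupV.
Qed.

Lemma subgroupX H x n : is_subgroup H -> H x -> H (x ^+ n)%g.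
Proof.
move=> sH Hx; elim: n => [|n IH]; first exact: subgroup1.
by rewrite expgS; exact: subgroupM.
Qed.

Lemma is_subgroup_generated X : is_subgroup (generated X).
Proof.
apply/is_subgroupP; split=> [H [sH _]|x y gx gy H [sH XH]].
  exact: subgroup1.
by case/is_subgroupP: (sH) => _; apply; [exact: gx|exact: gy].
Qed.

Lemma sub_generated X : X `<=` generated X.
Proof. exact: sub_gen_smallest. Qed.

Lemma generated_sub X H : is_subgroup H -> X `<=` H -> generated X `<=` H.
Proof. exact: smallest_sub. Qed.

Lemma generated_le X Y : X `<=` Y -> generated X `<=` generated Y.
Proof.
by move=> XY; apply: generated_sub; [exact: is_subgroup_generated|
  apply: subset_trans XY _; exact: sub_generated].
Qed.

(** The elements generated by some finite part of [X] form a subgroup, because two finite parts can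
    be united, and this subgroup contains [X]. *)
Lemma generated_finitary X x :
  generated X x -> exists Y, [/\ finite_set Y, Y `<=` X & generated Y x].
Proof.
have := @generated_sub X
  [set z | exists Y, [/\ finite_set Y, Y `<=` X & generated Y z]].
apply=> [|z Xz]; last first.
  by exists [set z]; split; [exact: finite_set1|move=> _ ->|exact: sub_generated].
apply/is_subgroupP; split=> /=.
  exists set0; split; [exact: finite_set0|exact: sub0set|].
  exact: subgroup1 (is_subgroup_generated _).
move=> y z [Y [fY YX gy]] [Z [fZ ZX gz]].
exists (Y `|` Z); split; first by rewrite finite_setU.
  by rewrite subUset.
case/is_subgroupP: (is_subgroup_generated (Y `|` Z)) => _; apply.
  by apply: generated_le gy; exact: subsetUl.
by apply: generated_le gz; exact: subsetUr.
Qed.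

Lemma generated_finite X Z : finite_set X -> X `<=` generated Z ->
  exists Y, [/\ finite_set Y, Y `<=` Z & X `<=` generated Y].
Proof.
move=> /finite_seqP[s ->]; elim: s => [_|x s IH xsZ].
  by exists set0; split; [exact: finite_set0|exact: sub0set|].
have [|Y [fY YZ sY]] := IH; first
  by move=> y ys; apply: xsZ; rewrite /= in_cons orbC [_ \in _]ys.
have [|Y' [fY' Y'Z xY']] := @generated_finitary Z x.
  by apply: xsZ; rewrite /= mem_head.
exists (Y `|` Y'); split; [by rewrite finite_setU|by rewrite subUset|].
move=> y; rewrite /= in_cons => /orP[/eqP ->|/sY].
  by apply: generated_le xY'; exact: subsetUr.
by apply: generated_le; exact: subsetUl.
Qed.

Lemma is_subgroup_iter_derived n H :
  is_subgroup H -> is_subgroup (iter n derived_subgroup H).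
Proof. by case: n => [//|n] _ /=; exact: is_subgroup_generated. Qed.

Lemma derived_subgroup_le H K :
  H `<=` K -> derived_subgroup H `<=` derived_subgroup K.
Proof.
move=> HK; apply: generated_le => _ [x Hx [y Hy <-]].
by exists x; [exact: HK|exists y; [exact: HK|]].
Qed.

Lemma iter_derived_le n H K :
  H `<=` K -> iter n derived_subgroup H `<=` iter n derived_subgroup K.
Proof. by move=> HK; elim: n => //= n; exact: derived_subgroup_le. Qed.

Lemma solvable_subgroupP H : is_subgroup H ->
  solvable_subgroup H <-> exists n, iter n derived_subgroup H `<=` [set 1%g].
Proof.
move=> sH; split=> [[n Hn]|[n Hn]]; exists n; first by rewrite Hn.
apply/seteqP; split=> // _ ->.
exact: subgroup1 (is_subgroup_iter_derived _ sH).
Qed.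

Lemma solvable_subgroup_le H K : is_subgroup H -> is_subgroup K ->
  H `<=` K -> solvable_subgroup K -> solvable_subgroup H.
Proof.
move=> sH sK HK /(solvable_subgroupP sK)[n Kn].
by apply/(solvable_subgroupP sH); exists n; apply: subset_trans Kn; exact: iter_derived_le.
Qed.

End Subgroups.

(** * Homomorphic images of solvable groups *)

Section Images.
Variables (K G : groupType) (phi : {multiplicative K -> G}).

Lemma multiplicative1 : phi 1%g = 1%g.
Proof. by apply: (mulgI (phi 1%g)); rewrite -gmulfM !mulg1. Qed.

Lemma multiplicativeV x : phi (x^-1)%g = (phi x)^-1%g.
Proof. by apply/esym/mulg1_eq; rewrite -gmulfM mulgV multiplicative1. Qed.

Lemma multiplicativeR x y : phi [~ x, y]%g = [~ phi x, phi y]%g.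
Proof. by rewrite !commgEl !conjgE !gmulfM !multiplicativeV. Qed.

Lemma is_subgroup_image (H : set K) : is_subgroup H -> is_subgroup (phi @` H).
Proof.
move=> sH; apply/is_subgroupP; split.
  by exists 1%g; [exact: subgroup1|exact: multiplicative1].
move=> _ _ [x Hx <-] [y Hy <-]; exists (x / y)%g; last by rewrite gmulfM multiplicativeV.
by case/is_subgroupP: sH => _; apply.
Qed.

Lemma iter_derived_image n (H : set K) :
  iter n derived_subgroup (phi @` H) `<=` phi @` iter n derived_subgroup H.
Proof.
elim: n => //= n IH.
apply: generated_sub; first by apply: is_subgroup_image; exact: is_subgroup_generated.
move=> _ [_ /IH[x Hx <-] [_ /IH[y Hy <-] <-]].
exists [~ x, y]%g; last exact: multiplicativeR.
by apply: sub_generated; exists x => //; exists y.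
Qed.

Lemma solvable_range :
  solvable_subgroup [set: K] -> solvable_subgroup (range phi).
Proof.
have sT : is_subgroup [set: K] by exact/is_subgroupP.
move=> /(solvable_subgroupP sT)[n Kn].
apply/solvable_subgroupP; first exact: is_subgroup_image.
exists n => _ /iter_derived_image[x /Kn -> <-].
by rewrite /= multiplicative1.
Qed.

End Images.

(** * Solvability of the groups [W n] *)

Section SolvableWreath.

Lemma wbaseM (A B : groupType) (u v : wreath A B) x :
  wbase (u * v)%g x = (wbase u x * wbase v (x * wtop u)%g)%g.
Proof. by []. Qed.

Lemma wtopM (A B : groupType) (u v : wreath A B) :
  wtop (u * v)%g = (wtop u * wtop v)%g.
Proof. by []. Qed.

Lemma wbaseV (A B : groupType) (u : wreath A B) x :
  wbase (u^-1)%g x = (wbase u (x * (wtop u)^-1)%g)^-1%g.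
Proof. by []. Qed.

Lemma wtopV (A B : groupType) (u : wreath A B) : wtop (u^-1)%g = (wtop u)^-1%g.
Proof. by []. Qed.

(** One derivation kills the top coordinate, since [B] is commutative. Inside the base group
    commutators are taken coordinatewise, so [n] more derivations suffice. *)
Lemma solvable_wreath (A B : groupType) : (forall x y : B, commute x y) ->
  solvable_subgroup [set: A] -> solvable_subgroup [set: wreath A B].
Proof.
move=> cB.
have sT (K : groupType) : is_subgroup [set: K] by exact/is_subgroupP.
move=> /(solvable_subgroupP (sT A))[n An].
apply/(solvable_subgroupP (sT _)); exists n.+1.
(* [L k] is the part of the base group with all coordinates in the [k]-th derived subgroup of [A].
   It bounds the derived subgroup of index [k.+1], the shift by one paying for the top
   coordinate. *)
pose L k := [set u : wreath A B | wtop u = 1%g /\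
  forall x, iter k derived_subgroup [set: A] (wbase u x)].
have sL k : is_subgroup (L k).
  have sD := is_subgroup_iter_derived k (sT A).
  apply/is_subgroupP; split; first by split=> // x; exact: subgroup1.
  move=> u v [tu bu] [tv bv]; split; first by rewrite wtopM wtopV tu tv divg1.
  move=> x; rewrite wbaseM wbaseV; apply: subgroupM => //.
  exact: subgroupV.
suff le k : iter k.+1 derived_subgroup [set: wreath A B] `<=` L k.
  move=> u /le[tu bu]; apply: wreath_eq => // x.
  exact: An.
elim: k => [|k IH]; apply: generated_sub => //.
  move=> _ [u _ [v _ <-]]; split=> //.
  rewrite commgEl conjgE !(wtopM, wtopV); apply/eqP/commgP; exact: cB.
move=> _ [u /IH[tu bu] [v /IH[tv bv] <-]]; split.
  by rewrite commgEl conjgE !(wtopM, wtopV) tu tv invg1 !mulg1.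
move=> x; apply: sub_generated; exists (wbase u x); first exact: bu.
exists (wbase v x); first exact: bv.
by rewrite !commgEl !conjgE !(wbaseM, wtopM, wbaseV, wtopV) tu tv !invg1 !mulg1.
Qed.

Lemma solvable_W n : solvable_subgroup [set: W n].
Proof.
elim: n => [|n IH].
  exists 0%N; apply/seteqP; split=> // u _.
  by have unitE (v : Datatypes.unit) : v = tt by case: v; exact: unitE.
apply: solvable_wreath IH => x y; exact: (@addrC int).
Qed.

End SolvableWreath.

(** * Integer powers in a group *)

Section IntegerPowers.
Variable G : groupType.
Implicit Types (t : G) (k l : int).

Definition zpow t k : G :=
  match k with Posz n => (t ^+ n)%g | Negz n => (t ^- n.+1)%g end.

Lemma zpowS t k : zpow t (k + 1) = (zpow t k * t)%g.
Proof.
case: k => [n|[|n]]; first by rewrite /= addn1 expgSr.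
  by rewrite /= mulVg.
rewrite (_ : Negz n.+1 + 1 = Negz n); last by rewrite !NegzE -addn1 PoszD opprD addrNK.
by rewrite /= [in RHS]expgS invgM mulgVK.
Qed.

Lemma zpowD t k l : zpow t (k + l) = (zpow t k * zpow t l)%g.
Proof.
elim: l => [|n IH|n IH]; first by rewrite addr0 mulg1.
  by rewrite -addn1 PoszD addrA !zpowS IH mulgA.
apply: (mulIg t); rewrite -mulgA -!zpowS -addrA.
by rewrite -addn1 PoszD opprD addrNK.
Qed.

End IntegerPowers.

(** * Recognising a wreath product with Z from a faithful right action with a wandering set *)

Section InternalWreath.
Variables (G : groupType) (T : Type) (act : T -> G -> T).
Hypothesis act1 : forall x, act x 1%g = x.
Hypothesis actM : forall x g h, act x (g * h)%g = act (act x g) h.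
Hypothesis act_faithful : forall g h, (forall x, act x g = act x h) -> g = h.
Variables (S : set T) (t : G).
Hypothesis S_neq0 : S !=set0.
Hypothesis S_wandering : forall k x, S x -> S (act x (zpow t k)) -> k = 0.

Let act_inj g : injective (act^~ g).
Proof.
by move=> x y /(congr1 (act^~ g^-1%g)); rewrite -!actM mulgV !act1.
Qed.

Section Realizations.
Variables (K : groupType) (phi : {multiplicative K -> G}).
Hypothesis phi_inj : injective phi.
Hypothesis phi_fix : forall a x, ~ S x -> act x (phi a) = x.

Local Notation Z := (GRing.to_multiplicative int).
Implicit Types (w u : wreath K Z) (k : int).

Let phi_stable a x : S x -> S (act x (phi a)).
Proof.
by move=> Sx; apply: contrapT => nS; apply: (nS); rewrite (act_inj (phi_fix a nS)).
Qed.

Definition off_translates x := forall k y, S y -> x <> act y (zpow t k).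

(** This describes the action that [w] should have: on the translate of [S] by [t^k], the conjugate
    of [phi (wbase w k)] followed by [t^(wtop w)]; away from all translates, only [t^(wtop w)]. As a
    relation it can be shown multiplicative, total and injective separately before any embedding is
    chosen. *)
Definition realizes w g : Prop :=
  (forall k x, S x -> act (act x (zpow t k)) g =
     act (act x (phi (wbase w k))) (zpow t (k + wtop w))) /\
  (forall x, off_translates x -> act x g = act x (zpow t (wtop w))).

Lemma realizes_functional w g h : realizes w g -> realizes w h -> g = h.
Proof.
move=> [g1 g2] [h1 h2]; apply: act_faithful => x.
have [offx|] := pselect (off_translates x); first by rewrite g2 // h2.
move=> /existsNP[k /existsNP[y]] /not_implyP[Sy /contrapT ->].
by rewrite g1 // h1.
Qed.

Lemma off_translates_zpow x k :
  off_translates x -> off_translates (act x (zpow t k)).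
Proof.
move=> offx l y Sy /(congr1 (act^~ (zpow t (- k)))).
by rewrite -!actM -!zpowD subrr act1; exact: offx.
Qed.

(** [phi] keeps [S] stable, so [g] carries the translate of index [k] to the one of index
    [k + wtop u]. The second factor is therefore read at exactly the shifted index found in
    [wbaseM]. *)
Lemma realizesM u w g h :
  realizes u g -> realizes w h -> realizes (u * w)%g (g * h)%g.
Proof.
move=> [g1 g2] [h1 h2]; split=> [k x Sx|x offx].
  rewrite actM g1 // h1; last exact: phi_stable.
  by rewrite wbaseM wtopM gmulfM actM addrA.
rewrite actM g2 // h2; last exact: off_translates_zpow.
by rewrite wtopM -actM -zpowD.
Qed.

Definition wtop_elt (m : Z) : wreath K Z := Wreath m (wone_finite K Z).

Lemma realizes_top m : realizes (wtop_elt m) (zpow t m).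
Proof.
split=> [k x Sx|x offx //].
by rewrite /= multiplicative1 act1 -actM -zpowD.
Qed.

Lemma wdelta_finite (k : Z) (a : K) :
  finite_set [set j : Z | (if j == k then a else 1%g) != 1%g].
Proof.
apply: sub_finite_set (finite_set1 k) => j /=.
by case: (j =P k) => //; rewrite eqxx.
Qed.

Definition wdelta (k : Z) (a : K) : wreath K Z := Wreath 1%g (wdelta_finite k a).

(** Conjugating by [t^k] moves the action of [phi a] from [S] to its translate of index [k]. By
    wandering, a point in a translate of another index [j] is pulled back outside [S], where [phi a]
    is trivial. *)
Lemma realizes_delta k a :
  realizes (wdelta k a) (zpow t (- k) * phi a * zpow t k)%g.
Proof.
split=> [j x Sx|x offx] /=.
  rewrite addr0 !actM -[act (act x _) _]actM -zpowD.
  case: eqVneq => [->|jk]; first by rewrite subrr act1.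
  rewrite multiplicative1 act1 phi_fix; last first.
    by move=> /(S_wandering Sx)/eqP; rewrite subr_eq0 (negbTE jk).
  by rewrite -actM -zpowD subrK.
rewrite !actM phi_fix; first by rewrite -actM -zpowD addNr.
move=> Sx; apply: (offx k _ Sx).
by rewrite -actM -zpowD addNr act1.
Qed.

(** Induction on a list containing the finite support of [w]: each step splits off one coordinate as
    a conjugate of an element of [range phi], and a power of [t] remains at the end. *)
Lemma realizes_exists w :
  exists2 g, generated (range phi `|` [set t]) g & realizes w g.
Proof.
have sg := is_subgroup_generated (range phi `|` [set t]).
have gt k : generated (range phi `|` [set t]) (zpow t k).
  have gt1 : generated (range phi `|` [set t]) t by apply: sub_generated; right.
  case: k => n; first exact: (subgroupX n sg gt1).
  exact: (subgroupV sg (subgroupX n.+1 sg gt1)).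
have [s ws] : exists s : seq Z, forall k, wbase w k != 1%g -> k \in s.
  have /finite_seqP[s ws] := wbase_finite w.
  by exists s => k wk; have : [set` s] k by rewrite -ws.
elim: s w ws => [|k s IH] w ws.
  have -> : w = wtop_elt (wtop w).
    by apply: wreath_eq => // k; apply/eqP; apply: contraT => /ws.
  by exists (zpow t (wtop w)); [exact: gt|exact: realizes_top].
have fw : finite_set [set j : Z | (if j == k then 1%g else wbase w j) != 1%g].
  apply: sub_finite_set (wbase_finite w) => j /=.
  by case: ifP => //; rewrite eqxx.
have [|h gh rh] := IH (Wreath (wtop w) fw).
  move=> j /=; have [_|jk wj] := eqVneq j k; first by rewrite eqxx.
  by have := ws j wj; rewrite in_cons (negbTE jk).
exists (zpow t (- k) * phi (wbase w k) * zpow t k * h)%g.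
  have gphi : generated (range phi `|` [set t]) (phi (wbase w k)).
    by apply: sub_generated; left; exists (wbase w k).
  exact: (subgroupM sg (subgroupM sg (subgroupM sg (gt _) gphi) (gt _)) gh).
(* With the delta on the left, whose top is trivial, the coordinates multiply without any shift. *)
have e : w = (wdelta k (wbase w k) * Wreath (wtop w) fw)%g.
  apply: wreath_eq => [j|]; last by rewrite wtopM mul1g.
  rewrite wbaseM /= mulg1; case: eqVneq => [->|_]; first by rewrite mulg1.
  by rewrite mul1g.
by have := realizesM (realizes_delta k (wbase w k)) rh; rewrite -e.
Qed.

(** The image of one point of [S] lies in the translates of index [wtop u] and [wtop w], so
    wandering identifies the tops. Cancelling the common power of [t] then recovers each
    [phi (wbase _ k)] on [S], while off [S] both sides fix every point. *)
Lemma realizes_inj u w g : realizes u g -> realizes w g -> u = w.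
Proof.
move=> [u1 _] [w1 _].
have tuw : wtop u = wtop w.
  have [x Sx] := S_neq0.
  have := u1 0 x Sx; rewrite w1 // !add0r => /(congr1 (act^~ (zpow t (- wtop u)))).
  have actD y k l : act (act y (zpow t k)) (zpow t l) = act y (zpow t (k + l)).
    by rewrite zpowD actM.
  rewrite !actD subrr act1 => e.
  apply/esym/eqP; rewrite -subr_eq0; apply/eqP.
  apply: (S_wandering (phi_stable (wbase w 0) Sx)).
  by rewrite e; exact: phi_stable.
apply: wreath_eq => // k; apply: phi_inj; apply: act_faithful => x.
have [Sx|nSx] := pselect (S x); last by rewrite !phi_fix.
by apply: (@act_inj (zpow t (k + wtop u))); rewrite /= -u1 // {1}tuw -w1.
Qed.

Definition wreath_embedding w : G := projT1 (cid2 (realizes_exists w)).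

Lemma wreath_embeddingP w : realizes w (wreath_embedding w).
Proof. by rewrite /wreath_embedding; case: cid2. Qed.

Lemma wreath_embedding_mul :
  {morph wreath_embedding : u w / (u * w)%g >-> (u * w)%g}.
Proof.
move=> u w; apply: realizes_functional (wreath_embeddingP _) _.
by apply: realizesM; exact: wreath_embeddingP.
Qed.

HB.instance Definition _ :=
  isMultiplicative.Build _ _ wreath_embedding wreath_embedding_mul.

Lemma wreath_embedding_inj : injective wreath_embedding.
Proof.
move=> u w uw; apply: realizes_inj (wreath_embeddingP u) _.
by rewrite uw; exact: wreath_embeddingP.
Qed.

Lemma range_wreath_embedding :
  range wreath_embedding = generated (range phi `|` [set t]).
Proof.
apply/seteqP; split=> [_ [w _ <-]|].
  by rewrite /wreath_embedding; case: cid2.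
apply: generated_sub.
  by apply: (@is_subgroup_image _ _ wreath_embedding); exact/is_subgroupP.
move=> _ [[a _ <-]|->].
  exists (wdelta 0 a) => //; apply: realizes_functional (wreath_embeddingP _) _.
  by have := realizes_delta 0 a; rewrite oppr0 mul1g mulg1.
exists (wtop_elt 1) => //; apply: realizes_functional (wreath_embeddingP _) _.
exact: realizes_top.
Qed.

End Realizations.

(** The elements fixing a given point form a subgroup, so triviality off [S] passes from [X] to
    [generated X], and the embedding applies to the given isomorphism [phi]. *)
Lemma isomorphic_to_wreath (X : set G) (K : groupType) :
  isomorphic_to (generated X) K ->
  (forall g, X g -> forall x, ~ S x -> act x g = x) ->
  isomorphic_to (generated (X `|` [set t])) (wreath K (GRing.to_multiplicative int)).
Proof.
move=> [phi [phi_inj rphi]] Xfix.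
have phi_fix a x : ~ S x -> act x (phi a) = x.
  move=> nSx; have : generated X (phi a) by rewrite -rphi; exists a.
  apply: (@generated_sub _ _ [set g | act x g = x]) => [|g /Xfix]; last exact.
  apply/is_subgroupP; split=> [|g h /= gx hx]; first exact: act1.
  by rewrite actM gx -{1}hx -actM mulgV act1.
exists (wreath_embedding phi_fix); split; first exact: wreath_embedding_inj.
rewrite range_wreath_embedding //.
have sg := is_subgroup_generated (X `|` [set t]).
apply/seteqP; split; last first.
  apply: generated_le; apply: setSU; rewrite rphi; exact: sub_generated.
apply: generated_sub => // g [|->]; last by apply: sub_generated; right.
by rewrite rphi; apply: generated_le; exact: subsetUl.
Qed.

End InternalWreath.

(** * Dyadic rationals *)

Section Dyadic.
Context {R : realType}.
Implicit Types (x y : R) (k : int).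

Lemma dyadic_int k : dyadic (k%:~R : R).
Proof. by exists k, 0%N; rewrite expr0 divr1. Qed.

Lemma dyadicN x : dyadic x -> dyadic (- x).
Proof. by move=> [z [n ->]]; exists (- z), n; rewrite mulrNz mulNr. Qed.

Lemma dyadicD x y : dyadic x -> dyadic y -> dyadic (x + y).
Proof.
move=> [z [n ->]] [w [m ->]]; exists (z * 2 ^+ m + w * 2 ^+ n), (n + m)%N.
have p2 i : (2 ^+ i : R) != 0 by rewrite expf_neq0 // pnatr_eq0.
rewrite rmorphD !rmorphM !rmorphXn /= exprD.
apply: (mulIf (mulf_neq0 (p2 n) (p2 m))); rewrite divfK ?mulf_neq0 //.
by rewrite mulrDl mulrA divfK // [2 ^+ n * _]mulrC mulrA divfK.
Qed.

Lemma dyadicB x y : dyadic x -> dyadic y -> dyadic (x - y).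
Proof. by move=> dx dy; apply: dyadicD => //; exact: dyadicN. Qed.

Lemma dyadic_pow2M k x : dyadic x -> dyadic (2 ^ k * x).
Proof.
move=> [z [n ->]]; case: k => m /=.
  by exists (z * 2 ^+ m), n; rewrite rmorphM rmorphXn /= mulrCA mulrA.
exists z, (n + m.+1)%N.
by rewrite -[_ ^ _]/((2 ^+ m.+1)^-1) exprD invfM mulrCA [X in _ * X]mulrC.
Qed.

Lemma dyadic_half x : dyadic x -> dyadic (x / 2).
Proof. by move=> /(dyadic_pow2M (-1)); rewrite mulrC exprN1. Qed.

Lemma dyadic_dense x y : x < y -> exists2 z, dyadic z & x < z < y.
Proof.
move=> xy; have yx0 : 0 < y - x by rewrite subr_gt0.
have p2 i : 0 < (2 ^+ i : R) by rewrite exprn_gt0.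
(* By [upper_nthrootP], [2 ^+ n] exceeds the inverse of the gap, so after scaling the gap is longer
   than 1 and contains the first integer above [x * 2 ^+ n]. *)
pose n := Num.bound (y - x)^-1.
have xyn : 1 < (y - x) * 2 ^+ n.
  by rewrite mulrC -ltr_pdivrMr // div1r; exact: upper_nthrootP.
pose z := Num.floor (x * 2 ^+ n) + 1.
have := floor_itv (x * 2 ^+ n); rewrite -/z => /andP[zx xz].
exists (z%:~R / 2 ^+ n); first by exists z, n.
rewrite ltr_pdivlMr // xz ltr_pdivrMr //=.
apply: le_lt_trans (_ : x * 2 ^+ n + 1 < _); last first.
  by move: xyn; rewrite mulrBl ltrBrDl.
by rewrite /z intrD lerD2r.
Qed.

End Dyadic.

(** * A subgroup of Thompson's group given by dyadic affine pieces *)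

Section DyadicPL.
Context {R : realType}.
Implicit Types (f g : PLo R) (S : set (unitI R)) (x y z a b : unitI R).

Definition misses S a b := forall s, S s -> ~ (\val a < \val s < \val b).

(* Unlike the definition of F, this also constrains the constant terms of the
   pieces, so that closure under composition needs no information on how
   elements of F act on dyadic numbers. *)
Definition dyadicPL f : Prop :=
  exists S, [/\ finite_set S, forall s, S s -> dyadic (\val s) &
    forall a b, misses S a b -> exists (k : int) (c : R), dyadic c /\
      forall x, \val a <= \val x <= \val b -> \val (f x) = 2 ^ k * \val x + c].

Lemma unitI_exists (r : R) : 0 <= r <= 1 -> exists x, \val x = r.
Proof.
move=> r01; have rI : r \in (`[0, 1]%classic : set R).
  by apply/mem_set; rewrite /= in_itv.
by exists (exist _ r rI).
Qed.

Lemma unitI_itv x : 0 <= \val x <= 1.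
Proof. by have := set_mem (valP x); rewrite /= in_itv. Qed.

(** Run through the points of [S]: each one found strictly inside the current interval becomes its
    new right end. *)
Lemma finite_gap_right S x y : finite_set S -> \val x < \val y ->
  exists z, [/\ \val x < \val z, \val z <= \val y & misses S x z].
Proof.
move=> /finite_seqP[s ->] xy; elim: s => [|u s [z [xz zy sz]]].
  by exists y; split=> // u.
have [xuz|xuz] := boolP (\val x < \val u < \val z); last first.
  exists z; split=> // v; rewrite /= in_cons => /orP[/eqP ->|/sz //].
  exact/negP.
case/andP: xuz => xu uz; exists u; split=> //; first exact: le_trans (ltW uz) zy.
move=> v; rewrite /= in_cons => /orP[/eqP -> /andP[_]|/sz vz /andP[xv vu]].
  by rewrite ltxx.
by apply: vz; rewrite xv (lt_trans vu uz).
Qed.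

Lemma finite_gap_left S x y : finite_set S -> \val x < \val y ->
  exists z, [/\ \val x <= \val z, \val z < \val y & misses S z y].
Proof.
move=> /finite_seqP[s ->] xy; elim: s => [|u s [z [xz zy sz]]].
  by exists x; split=> // u.
have [zuy|zuy] := boolP (\val z < \val u < \val y); last first.
  exists z; split=> // v; rewrite /= in_cons => /orP[/eqP ->|/sz //].
  exact/negP.
case/andP: zuy => zu uy; exists u; split=> //; first exact: le_trans xz (ltW zu).
move=> v; rewrite /= in_cons => /orP[/eqP -> /andP[]|/sz vz /andP[uv vy]].
  by rewrite ltxx.
by apply: vz; rewrite vy (lt_trans zu uv).
Qed.

Lemma dyadicPL_thompsonF f : dyadicPL f -> thompsonF R f.
Proof.
move=> [S [fS dS fE]]; split=> [x [/andP[x0 x1] nx]|m [a [b [ab [c fab]]]]].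
  apply: contrapT => ndx; apply: nx.
  have [|o oE] := @unitI_exists 0; first by rewrite lexx ler01.
  have [|i iE] := @unitI_exists 1; first by rewrite lexx ler01.
  have [|a [_ ax Sax]] := @finite_gap_left S o x fS; first by rewrite oE.
  have [|b [xb _ Sxb]] := @finite_gap_right S x i fS; first by rewrite iE.
  (* The gaps on both sides of [x] merge into one piece, because [x], not being dyadic, is not in
     [S]. *)
  have [s Ss /andP[as_ sb]|k [d [_ fab]]] := fE a b.
    have [sx|xs|/val_inj sx] := ltgtP (\val s) (\val x).
    - by apply: (Sax s Ss); rewrite as_.
    - by apply: (Sxb s Ss); rewrite xs.
    - by apply: ndx; rewrite -sx; exact: dS.
  by exists a, b, (2 ^ k); rewrite ax xb; split=> //; exists d.
(* The interval witnessing the slope may contain points of [S]. It is shortened to lie in one piece,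
   and the values at its two ends determine the slope. *)
have [z [az zb Saz]] := finite_gap_right fS ab.
have [k [d [_ faz]]] := fE _ _ Saz.
exists k.
have ea : \val (f a) = 2 ^ k * \val a + d by apply: faz; rewrite lexx ltW.
have ez : \val (f z) = 2 ^ k * \val z + d by apply: faz; rewrite lexx ltW.
rewrite fab ?lexx ?ltW // in ea.
rewrite fab ?zb ?ltW // in ez.
have za0 : \val z - \val a != 0 by rewrite subr_eq0 gt_eqF.
apply: (mulIf za0); rewrite !mulrBr.
by move: ea ez; lra.
Qed.

(** The degenerate interval from [x] to [x] misses every set, so [f] is given at [x] by a dyadic
    affine formula, which can be solved for [x]. *)
Lemma dyadicPL_dyadic f x : dyadicPL f -> dyadic (\val (f x)) -> dyadic (\val x).
Proof.
move=> [S [_ _ fE]] dfx; have [s Ss /andP[xs sx]|k [c [dc fx]]] := fE x x.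
  by have := lt_trans xs sx; rewrite ltxx.
have -> : \val x = 2 ^ (- k) * (\val (f x) - c).
  rewrite fx ?lexx // addrK mulrA -expfzDr ?pnatr_eq0 //.
  by rewrite addNr expr0z mul1r.
by apply: dyadic_pow2M; exact: dyadicB.
Qed.

Lemma dyadic_dyadicPL f x : dyadicPL f -> dyadic (\val x) -> dyadic (\val (f x)).
Proof.
move=> [S [_ _ fE]] dx; have [s Ss /andP[xs sx]|k [c [dc fx]]] := fE x x.
  by have := lt_trans xs sx; rewrite ltxx.
by rewrite fx ?lexx //; apply: dyadicD => //; exact: dyadic_pow2M.
Qed.

Lemma PLoVK f : cancel (f^-1)%g f.
Proof. by move=> x; rewrite -[RHS]/((1 : PLo R)%g x) -(mulVg f). Qed.

Lemma PLo_lt f x y : (\val (f x) < \val (f y)) = (\val x < \val y).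
Proof.
have [_ fh _] := PLo_prop f.
apply/idP/idP; last exact: fh.
by apply: contraTT; rewrite -!leNgt; exact: homo_PLo_le.
Qed.

Lemma PLo_le f x y : (\val (f x) <= \val (f y)) = (\val x <= \val y).
Proof. by rewrite !leNgt PLo_lt. Qed.

Lemma dyadicPL1 : dyadicPL 1%g.
Proof.
exists set0; split=> // a b _; exists 0, 0; split=> [|x _].
  exact: (dyadic_int 0).
by rewrite expr0z mul1r addr0.
Qed.

(** The pieces are cut at the points for [f] and at the preimages under [f] of those for [g]; the
    latter are dyadic by [dyadicPL_dyadic]. *)
Lemma dyadicPLM f g : dyadicPL f -> dyadicPL g -> dyadicPL (f * g)%g.
Proof.
move=> fd gd; have [S [fS dS fE]] := fd; have [S' [fS' dS' gE]] := gd.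
exists (S `|` (f^-1)%g @` S'); split.
- by rewrite finite_setU; split=> //; exact: finite_image.
- move=> s [/dS //|[u S'u <-]]; apply: (dyadicPL_dyadic fd).
  by rewrite PLoVK; exact: dS'.
move=> a b Sab.
have [k [c [dc fab]]] : exists (k : int) (c : R), dyadic c /\
    forall x, \val a <= \val x <= \val b -> \val (f x) = 2 ^ k * \val x + c.
  by apply: fE => s Ss; apply: Sab; left.
have [|l [d [dd gab]]] := gE (f a) (f b).
  move=> s S's; rewrite -[s](PLoVK f) !PLo_lt.
  by apply: Sab; right; exists s.
exists (l + k), (2 ^ l * c + d); split.
  by apply: dyadicD => //; exact: dyadic_pow2M.
move=> x axb; rewrite -[(f * g)%g x]/(g (f x)) gab ?PLo_le // fab //.
by rewrite mulrDr mulrA expfzDr ?pnatr_eq0 // addrA.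
Qed.

Lemma dyadicPLV f : dyadicPL f -> dyadicPL (f^-1)%g.
Proof.
move=> fd; have [S [fS dS fE]] := fd; exists (f @` S); split.
- exact: finite_image.
- by move=> _ [s /dS ds <-]; exact: dyadic_dyadicPL.
move=> a b Sab.
have [|k [c [dc fab]]] := fE ((f^-1)%g a) ((f^-1)%g b).
  move=> s Ss; rewrite -(PLo_lt f) -(PLo_lt f s) !PLoVK.
  by apply: Sab; exists s.
exists (- k), (- (2 ^ (- k) * c)); split.
  by apply: dyadicN; exact: dyadic_pow2M.
move=> x axb; have := fab ((f^-1)%g x).
rewrite !PLo_le PLoVK => -> //.
rewrite mulrDr addrK mulrA -expfzDr ?pnatr_eq0 //.
by rewrite addNr expr0z mul1r.
Qed.

Lemma is_subgroup_dyadicPL : is_subgroup [set f | dyadicPL f].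
Proof.
apply/is_subgroupP; split=> [|f g fd gd]; first exact: dyadicPL1.
by apply: dyadicPLM => //; exact: dyadicPLV.
Qed.

End DyadicPL.

(** * A real one-bump function and its inverse *)

Section Bump.
Context {R : realType}.
Implicit Types (F G : R -> R) (x y : R).

(** Nondecreasing and 2-Lipschitz, 2 being the largest slope of the bump and of its inverse. Both
    properties survive max and min, so they pass from the affine pieces to the bump. *)
Definition slow_increasing F :=
  forall x y, x <= y -> F x <= F y <= F x + 2 * (y - x).

Lemma slow_increasing_max F G : slow_increasing F -> slow_increasing G ->
  slow_increasing (fun x => Num.max (F x) (G x)).
Proof.
move=> HF HG x y xy; have := HF x y xy; have := HG x y xy.
by case: (leP (F x) (G x)); case: (leP (F y) (G y)); lra.
Qed.

Lemma slow_increasing_min F G : slow_increasing F -> slow_increasing G ->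
  slow_increasing (fun x => Num.min (F x) (G x)).
Proof.
move=> HF HG x y xy; have := HF x y xy; have := HG x y xy.
by case: (leP (F x) (G x)); case: (leP (F y) (G y)); lra.
Qed.

Lemma slow_increasing_continuous F : slow_increasing F -> continuous F.
Proof.
move=> HF x; apply/cvgrPdist_lt => e e0.
near=> y.
have xy : `|x - y| < e / 2 by near: y; apply: cvgr_dist_lt; rewrite ?divr_gt0.
move: xy; rewrite !ltr_norml; have [xy|yx] := leP x y.
  by have := HF _ _ xy; lra.
by have := HF _ _ (ltW yx); lra.
Unshelve. all: by end_near. Qed.

(* The identity off [a, b], with slopes 2, 1 and 1/2 on [a, a + h],
   [a + h, b - 2 * h] and [b - 2 * h, b]. *)
Definition plbump a b h x :=
  Num.max x (Num.min (2 * x - a) (Num.min (x + h) ((x + b) / 2))).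

(** For increasing bijections, inversion exchanges max and min: each affine piece of [plbump] is
    inverted and the two operations are swapped. *)
Definition plbump_inv a b h y :=
  Num.min y (Num.max ((y + a) / 2) (Num.max (y - h) (2 * y - b))).

Lemma slow_increasing_bump a b h : slow_increasing (plbump a b h).
Proof.
apply: slow_increasing_max; first by move=> x y; lra.
apply: slow_increasing_min; first by move=> x y; lra.
by apply: slow_increasing_min => x y; lra.
Qed.

Lemma slow_increasing_bump_inv a b h : slow_increasing (plbump_inv a b h).
Proof.
apply: slow_increasing_min; first by move=> x y; lra.
apply: slow_increasing_max; first by move=> x y; lra.
by apply: slow_increasing_max => x y; lra.
Qed.

Section Pieces.
Variables (a b h : R).

(** The bound [3 * h <= b - a] puts the breakpoints [a], [a + h], [b - 2 * h], [b] in this order. *)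
Lemma plbump_eq x z : 0 < h -> 3 * h <= b - a ->
  [\/ z = x /\ (x <= a \/ b <= x),
      z = 2 * x - a /\ a <= x <= a + h,
      z = x + h /\ a + h <= x <= b - 2 * h |
      z = (x + b) / 2 /\ b - 2 * h <= x <= b] ->
  plbump a b h x = z.
Proof.
move=> h0 hab H; rewrite /plbump.
case: (leP (x + h)) => ?; case: (leP (2 * x - a)) => ?; case: leP => ?;
  by case: H => -[]; lra.
Qed.

Lemma plbump_cases x : 0 < h -> 3 * h <= b - a ->
  [\/ plbump a b h x = x /\ (x <= a \/ b <= x),
      plbump a b h x = 2 * x - a /\ a <= x <= a + h,
      plbump a b h x = x + h /\ a + h <= x <= b - 2 * h |
      plbump a b h x = (x + b) / 2 /\ b - 2 * h <= x <= b].
Proof.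
move=> h0 hab.
have [xa|/ltW ax] := leP x a.
  by apply: Or41; split; [apply: plbump_eq => //; apply: Or41; split=> //; left|left].
have [xh|/ltW hx] := leP x (a + h).
  by apply: Or42; split; [apply: plbump_eq => //; apply: Or42; split=> //|]; lra.
have [xb|/ltW bx] := leP x (b - 2 * h).
  by apply: Or43; split; [apply: plbump_eq => //; apply: Or43; split=> //|]; lra.
have [xb|/ltW xb] := leP x b.
  by apply: Or44; split; [apply: plbump_eq => //; apply: Or44; split=> //|]; lra.
by apply: Or41; split; [apply: plbump_eq => //; apply: Or41; split=> //; right|right].
Qed.

Lemma plbumpK : 0 < h -> 3 * h <= b - a -> cancel (plbump a b h) (plbump_inv a b h).
Proof.
move=> h0 hab x; rewrite /plbump_inv.
have := plbump_cases x h0 hab; move: (plbump a b h x) => z H.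
case: (leP (z - h)) => ?; case: (leP ((z + a) / 2)) => ?; case: leP => ?;
  by case: H => -[]; lra.
Qed.

(** A max-min combination of strictly increasing maps is strictly increasing. Injectivity turns the
    left inverse [plbumpK] into a right inverse. *)
Lemma plbump_inv_inj : injective (plbump_inv a b h).
Proof.
suff inc x y : x < y -> plbump_inv a b h x < plbump_inv a b h y.
  by move=> x y e; case: (ltgtP x y) => // /inc; rewrite e ltxx.
move=> xy; rewrite /plbump_inv.
case: (leP (x - h)) => ?; case: (leP ((x + a) / 2)) => ?; case: (leP x) => ?;
case: (leP (y - h)) => ?; case: (leP ((y + a) / 2)) => ?; case: (leP y) => ?;
  lra.
Qed.

Lemma plbump_invK : 0 < h -> 3 * h <= b - a -> cancel (plbump_inv a b h) (plbump a b h).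
Proof. by move=> h0 hab y; apply: plbump_inv_inj; rewrite plbumpK. Qed.

End Pieces.

End Bump.

(** * Bumps as elements of Thompson's group *)

Section BumpElements.
Context {R : realType}.
Implicit Types (f g : PLo R) (x y u v : unitI R).

Lemma unitI_lift (F : R -> R) : (forall r, 0 <= r <= 1 -> 0 <= F r <= 1) ->
  exists f : unitI R -> unitI R, forall x, \val (f x) = F (\val x).
Proof.
move=> F01; have /choice[f fF] : forall x, exists y : unitI R, \val y = F (\val x).
  by move=> x; apply: unitI_exists; apply: F01; exact: unitI_itv.
by exists f.
Qed.

Lemma unitI_continuous (F : R -> R) (f : unitI R -> unitI R) : continuous F ->
  (forall x, \val (f x) = F (\val x)) -> continuous f.
Proof.
move=> cF fF; apply: continuous_comp_initial => x.
rewrite (_ : _ \o f = F \o set_val); last by apply/funext => y; exact: fF.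
by apply: continuous_comp; [exact: initial_continuous|exact: cF].
Qed.

Lemma PLo_bump (a b h : R) : 0 <= a -> b <= 1 -> 0 < h -> 3 * h <= b - a ->
  dyadic a -> dyadic b -> dyadic h ->
  exists2 g, dyadicPL g & forall x, \val (g x) = plbump a b h (\val x).
Proof.
move=> a0 b1 h0 hab da db dh.
have plbump01 (r : R) : 0 <= r <= 1 -> 0 <= plbump a b h r <= 1.
  by case/andP=> r0 r1; case: (plbump_cases r h0 hab) => -[->]; lra.
have plbump_inv01 (r : R) : 0 <= r <= 1 -> 0 <= plbump_inv a b h r <= 1.
  case/andP=> r0 r1; rewrite /plbump_inv.
  by case: (leP (r - h)) => ?; case: (leP ((r + a) / 2)) => ?; case: (leP r) => ?; lra.
have [f fE] := unitI_lift plbump01.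
have [f' f'E] := unitI_lift plbump_inv01.
have fK : cancel f f' by move=> x; apply: val_inj; rewrite f'E fE plbumpK.
have f'K : cancel f' f by move=> x; apply: val_inj; rewrite fE f'E plbump_invK.
have piece : exists S, [/\ finite_set S, forall s : unitI R, S s -> dyadic (\val s) &
    forall u v, misses S u v -> exists (k : int) (c : R), dyadic c /\
      forall x, \val u <= \val x <= \val v -> \val (f x) = 2 ^ k * \val x + c].
  have d2h : dyadic (2 * h) by exact: (dyadic_pow2M 1).
  pose s := [:: a; a + h; b - 2 * h; b].
  exists [set x | \val x \in s]; split.
  - apply: (@finite_preimage _ _ [set` s]); last exact: finite_seq.
    by move=> x y _ _; exact: val_inj.
  - move=> x; rewrite /= !inE => /or4P[] /eqP -> //.
      exact: dyadicD.
    exact: dyadicB.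
  move=> u v misss.
  (* Each breakpoint lies on one side of an interval that misses them all; testing them from left to
     right finds the single piece containing the interval. *)
  have outside r : r \in s -> 0 <= r <= 1 -> r <= \val u \/ \val v <= r.
    move=> rs r01; have [x xr] := unitI_exists r01.
    have := misss x; rewrite /= xr => /(_ rs)/negP.
    by rewrite negb_and -!leNgt => /orP.
  have [au|va] : a <= \val u \/ \val v <= a.
  - by apply: outside; [rewrite !inE eqxx|lra].
  2: { exists 0, 0; split=> [|x xuv]; first exact: (dyadic_int 0).
    by rewrite fE expr0z mul1r addr0; apply: plbump_eq => //; apply: Or41;
      split=> //; lra. }
  have [hu|vh] : a + h <= \val u \/ \val v <= a + h.
  - by apply: outside; [rewrite !inE eqxx orbT|lra].
  2: { exists 1, (- a); split=> [|x xuv]; first exact: dyadicN.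
    by rewrite fE expr1z; apply: plbump_eq => //; apply: Or42; split=> //; lra. }
  have [bu|vb] : b - 2 * h <= \val u \/ \val v <= b - 2 * h.
  - by apply: outside; [rewrite !inE eqxx !orbT|lra].
  2: { exists 0, h; split=> [//|x xuv].
    by rewrite fE expr0z mul1r; apply: plbump_eq => //; apply: Or43;
      split=> //; lra. }
  have [bu'|vb] : b <= \val u \/ \val v <= b.
  - by apply: outside; [rewrite !inE eqxx !orbT|lra].
  2: { exists (-1), (b / 2); split=> [|x xuv]; first exact: dyadic_half.
    by rewrite fE exprN1; apply: plbump_eq => //; apply: Or44; split; lra. }
  exists 0, 0; split=> [|x xuv]; first exact: (dyadic_int 0).
  by rewrite fE expr0z mul1r addr0; apply: plbump_eq => //; apply: Or41; split=> //; lra.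
suff fP : is_PLo f by exists (MkPLo fP).
split.
- split.
    apply: unitI_continuous fE.
    exact: slow_increasing_continuous (slow_increasing_bump _ _ _).
  exists f'; split=> //.
  apply: unitI_continuous f'E.
  exact: slow_increasing_continuous (slow_increasing_bump_inv _ _ _).
(* [slow_increasing] gives only weak monotonicity; injectivity of [f] makes it strict. *)
- move=> x y xy; rewrite lt_neqAle; apply/andP; split.
    apply/negP => /eqP/val_inj/(can_inj fK) e; move: xy; by rewrite e ltxx.
  by rewrite !fE; case/andP: (slow_increasing_bump a b h (ltW xy)).
- have [S [fS _ SE]] := piece; exists S => // u v /SE[k [c [_ fuv]]].
  by exists (2 ^ k), c.
Qed.

Lemma PLo_expgS g n x : (g ^+ n.+1)%g x = (g ^+ n)%g (g x).
Proof. by rewrite expgS. Qed.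

Lemma PLo_expgSr g n x : (g ^+ n.+1)%g x = g ((g ^+ n)%g x).
Proof. by rewrite expgSr. Qed.

(** A bump [g] with a small dyadic step [h] translates by [h] in the middle of its support. A large
    power keeps the support and carries [a'] past [b']. *)
Lemma displacing_element (a a' b' b : R) : dyadic a -> dyadic b ->
  0 <= a -> a < a' -> a' <= b' -> b' < b -> b <= 1 ->
  exists f, [/\ dyadicPL f, forall x, \val x <= \val (f x),
    Defs.support f = [set x | a < \val x < b] &
    forall x, a' <= \val x -> b' <= \val (f x)].
Proof.
move=> da db a0 aa' a'b' b'b b1.
(* This choice gives [a + h < a'] and [b' < b - 2 * h], so the translation piece covers everything
   from [a'] to [b']. *)
have [h dh] : exists2 h : R, dyadic h & 0 < h < Num.min (a' - a) (b - b') / 2.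
  by apply: dyadic_dense; rewrite divr_gt0 // lt_min !subr_gt0 aa'.
rewrite ltr_pdivlMr // lt_min => /andP[h0 /andP[ha hb]].
have hab : 3 * h <= b - a by lra.
have [g gd gE] := PLo_bump a0 b1 h0 hab da db dh.
have g_ge x : \val x <= \val (g x).
  by rewrite gE; case: (plbump_cases (\val x) h0 hab) => -[->]; lra.
have g_fix x : g x <> x <-> a < \val x < b.
  split=> [gx|].
    apply: contrapT => nx; apply: gx; apply: val_inj; rewrite gE.
    apply: plbump_eq => //; apply: Or41; split=> //; lra.
  move=> ax /(congr1 val); rewrite gE.
  by case: (plbump_cases (\val x) h0 hab) => -[->]; lra.
have gn_ge n x : \val x <= \val ((g ^+ n)%g x).
  elim: n => [|n IH] //; rewrite PLo_expgSr; exact: le_trans (g_ge _).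
have gn_fix n x : (g ^+ n.+1)%g x <> x <-> g x <> x.
  split=> gx e; apply: gx.
    by elim: n.+1 => [//|m IH]; rewrite PLo_expgS e.
  (* A point fixed by a power is squeezed: [x <= g x <= (g ^+ n.+1) x = x]. *)
  apply: val_inj; apply/le_anti.
  by rewrite g_ge -[X in _ <= \val X]e PLo_expgS gn_ge.
have gn_up n x : a' <= \val x ->
    a' + n%:R * h <= \val ((g ^+ n)%g x) \/ b' <= \val ((g ^+ n)%g x).
  move=> a'x; elim: n => [|n IH]; first by left; rewrite mul0r addr0.
  have := gn_ge n x; rewrite PLo_expgSr; move: ((g ^+ n)%g x) IH => y IH xy.
  rewrite -natr1 mulrDl mul1r; move: IH; move: (n%:R * h) => m IH.
  by rewrite gE; case: (plbump_cases (\val y) h0 hab) => -[->]; lra.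
(* [N] steps of length [h] already cover the distance; the exponent used is [N.+1] so that [gn_fix]
   applies. *)
pose N := Num.bound ((b' - a') / h).
have hN : b' <= a' + N.+1%:R * h.
  have : (b' - a') / h < N%:R.
    by apply: le_lt_trans (archi_boundP _); rewrite ?divr_ge0 ?subr_ge0 // ltW.
  by rewrite ltr_pdivrMr // -natr1 mulrDl; lra.
exists (g ^+ N.+1)%g; split.
- exact: subgroupX is_subgroup_dyadicPL gd.
- exact: gn_ge.
- apply/seteqP; split=> x gx.
    exact: (proj1 (g_fix x) (proj1 (gn_fix N x) gx)).
  exact: (proj2 (gn_fix N x) (proj2 (g_fix x) gx)).
by move=> x /(gn_up N.+1)[|//]; exact: le_trans.
Qed.

End BumpElements.

(** * Embedding a countable order into disjoint dyadic gaps *)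

Section Embedding.
Context {R : realType}.
Implicit Types A B : set nat.

(** The exponent [k.+2] makes all weights together sum to 1/2, the room on either side of the centre
    of the unit interval. *)
Definition weight A n : R := \sum_(0 <= k < n | k \in A) (2 ^+ k.+2)^-1.

Definition total_weight A : R := sup (range (weight A)).

Lemma weightS A n :
  weight A n.+1 = weight A n + (if n \in A then (2 ^+ n.+2)^-1 else 0).
Proof.
by rewrite /weight big_mkcond big_nat_recr //= -big_mkcond.
Qed.

Lemma half_pow_gt0 n : 0 < (2 ^+ n)^-1 :> R.
Proof. by rewrite invr_gt0 exprn_gt0. Qed.

Lemma half_pow_ge0 n : 0 <= (2 ^+ n)^-1 :> R.
Proof. exact/ltW/half_pow_gt0. Qed.

Lemma weight_le_add A B j n : A `<=` B -> B j -> ~ A j ->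
  weight A n + (if (j < n)%N then (2 ^+ j.+2)^-1 else 0) <= weight B n.
Proof.
move=> AB Bj nAj; elim: n => [|n IH]; first by rewrite /weight !big_geq // addr0.
rewrite !weightS addrAC.
have [jn|jn|ejn] := ltngtP j n.
- move: IH; rewrite jn (leqW jn) => IH; apply: lerD => //.
  by case: ifPn => [/set_mem/AB/mem_set -> //|_]; case: ifP.
- have jSn : (j < n.+1)%N = false by rewrite ltnS leqNgt jn.
  move: IH; rewrite jSn (leq_gtF (ltnW jn)) !addr0 => IH.
  apply: lerD => //; by case: ifPn => [/set_mem/AB/mem_set -> //|_]; case: ifP.
move: IH; rewrite -ejn ltnn ltnSn addr0 (mem_set Bj) => IH.
have -> : (j \in A) = false by apply/negbTE/negP => /set_mem.
by rewrite addr0 lerD2r.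
Qed.

(** The subtracted tail makes the bound inductive: adding the next weight at most halves it. *)
Lemma weight_le_half A n : weight A n <= 2^-1 - (2 ^+ n.+1)^-1.
Proof.
elim: n => [|n IH]; first by rewrite /weight big_geq // expr1 subrr.
rewrite weightS.
have pos := half_pow_gt0 n.+2.
have e2 : (2 ^+ n.+1)^-1 = 2 * (2 ^+ n.+2)^-1 :> R.
  by rewrite (exprS _ n.+1) invfM mulVKf // pnatr_eq0.
by move: IH pos; rewrite e2; move: (2 ^+ n.+2)^-1 => r; case: ifP => _; lra.
Qed.

Lemma weight_has_ubound A : has_ubound (range (weight A)).
Proof.
exists 2^-1 => _ [n _ <-]; apply: le_trans (weight_le_half A n) _.
by rewrite lerBlDr lerDl half_pow_ge0.
Qed.

Lemma weight_le_total A n : weight A n <= total_weight A.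
Proof. by apply: (ub_le_sup (weight_has_ubound A)); exists n. Qed.

Lemma total_weight_ge0 A : 0 <= total_weight A.
Proof. by apply: le_trans (weight_le_total A 0); rewrite /weight big_geq. Qed.

Lemma total_weight_le_half A : total_weight A <= 2^-1.
Proof.
apply: ge_sup; first by exists (weight A 0), 0%N.
move=> _ [n _ <-]; apply: le_trans (weight_le_half A n) _.
by rewrite lerBlDr lerDl half_pow_ge0.
Qed.

Lemma weight_nondecreasing A n m : weight A n <= weight A (n + m).
Proof.
elim: m => [|m IH]; first by rewrite addn0.
rewrite addnS weightS; apply: le_trans IH _; rewrite lerDl.
by case: ifP => // _; rewrite invr_ge0 exprn_ge0.
Qed.

Lemma total_weight_gap A B j : A `<=` B -> B j -> ~ A j ->
  total_weight A + (2 ^+ j.+2)^-1 <= total_weight B.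
Proof.
move=> AB Bj nAj; rewrite -lerBrDr; apply: ge_sup.
  by exists (weight A 0), 0%N.
(* The partial sum of [B] is taken up to [n + j.+1], so that it has already counted [j]. *)
move=> _ [n _ <-]; rewrite lerBrDr; apply: le_trans (weight_le_total B (n + j.+1)).
apply: le_trans (weight_le_add (n + j.+1) AB Bj nAj).
by rewrite addnS ltnS leq_addl; apply: lerD => //; rewrite -addnS weight_nondecreasing.
Qed.

(* Each [c] gets its own open gap, above the total weight of its predecessors. *)
Lemma countable_order_dyadic_gaps (d : Order.disp_t) (C : orderType d) :
  countable [set: C] -> exists p q : C -> R,
    [/\ forall c, dyadic (p c) /\ dyadic (q c),
        forall c, [/\ 0 < p c, p c < q c & q c < 2^-1] &
        forall c c', (c < c')%O -> q c < p c'].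
Proof.
move=> /countable_injP[i i_inj].
pose below c := [set k | exists2 c', (c' < c)%O & i c' = k].
have not_below c : ~ below c (i c).
  move=> [c' + /i_inj cc']; by rewrite cc' ?inE // ltxx.
pose s c := total_weight (below c).
pose e c : R := (2 ^+ (i c).+2)^-1.
have e0 c : 0 < e c by exact: half_pow_gt0.
(* The interval from [s c] to [s c + e c] is reserved for [c]: any later [c'] also counts the index
   [i c], so [s c'] is at least [s c + e c]. *)
have /choice[pq pqE] : forall c, exists r : R * R,
    [/\ dyadic r.1, dyadic r.2, s c < r.1, r.1 < r.2 & r.2 < s c + e c].
  move=> c; have [|p dp /andP[sp pe]] := @dyadic_dense _ (s c) (s c + e c).
    by rewrite ltrDl.
  have [q dq /andP[pq qe]] := dyadic_dense pe.
  by exists (p, q).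
exists (fun c => (pq c).1), (fun c => (pq c).2); split.
- by move=> c; have [] := pqE c.
- move=> c; have [_ _ sp pq_ qe] := pqE c; split=> //.
    exact: le_lt_trans (total_weight_ge0 _) sp.
  (* [below c] omits [i c], so [s c + e c] is still bounded by the weight of all indices. *)
  apply: lt_le_trans qe _; apply: le_trans (total_weight_le_half setT).
  exact: total_weight_gap.
move=> c c' cc'; have [_ _ _ _ qe] := pqE c; have [_ _ sp _ _] := pqE c'.
apply: lt_trans qe _; apply: le_lt_trans sp; apply: total_weight_gap => //.
  by move=> k [x xc <-]; exists x => //; exact: lt_trans cc'.
by exists c.
Qed.

End Embedding.

(** * Chains of displacing elements and the groups they generate *)

Section WanderingElements.
Context {R : realType}.
Implicit Types (f g : PLo R) (x y : unitI R).

(** A positive power moves points at least as far as [f] does, hence beyond [b]. For a negative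
    power, the opposite positive power is applied to the image point. *)
Lemma displacing_wandering f (a b : R) :
  (forall x, \val x <= \val (f x)) ->
  (forall x, a <= \val x -> b <= \val (f x)) ->
  forall k x, a < \val x < b -> a < \val ((zpow f k) x) < b -> k = 0.
Proof.
move=> f_ge f_disp.
have fn_ge n x : \val x <= \val ((f ^+ n)%g x).
  elim: n => [|n IH] //; rewrite PLo_expgSr; exact: le_trans (f_ge _).
have out n x : a < \val x -> ~ \val ((f ^+ n.+1)%g x) < b.
  move=> /ltW/f_disp bfx; apply/negP; rewrite -leNgt PLo_expgS.
  exact: le_trans (fn_ge _ _).
case=> [[|n]|n] x // /andP[ax xb] /andP[ay yb]; first by case: (out n x ax).
case: (out n _ ay).
by rewrite -[X in \val X]/((f ^- n.+1 * f ^+ n.+1)%g x) mulVg.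
Qed.

Section Chain.
Variables (d : Order.disp_t) (C : orderType d) (f : C -> PLo R).
Variable S : C -> set (unitI R).
Hypothesis S_neq0 : forall c, S c !=set0.
Hypothesis S_wandering : forall c k x, S c x -> S c ((zpow (f c) k) x) -> k = 0.
Hypothesis f_S : forall c c', (c < c')%O -> Defs.support (f c) `<=` S c'.

(** The list is decreasing, so its head supplies the top generator and the tail the base of the
    outermost wreath product. *)
Lemma isomorphic_to_W (s : seq C) : sorted >%O s ->
  isomorphic_to (generated (f @` [set` s])) (W (size s)).
Proof.
elim: s => [_|c s IH ss].
  pose one (u : W 0) : PLo R := 1%g.
  have oneM : {morph one : x y / (x * y)%g} by move=> x y; rewrite /one mulg1.
  pose phi : {multiplicative W 0 -> PLo R} :=
    HB.pack one (isMultiplicative.Build _ _ one oneM).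
  exists phi; split.
    have unit_eq (x y : Datatypes.unit) : x = y by case: x; case: y.
    by move=> x y _; exact: unit_eq.
  apply/seteqP; split=> [_ [u _ <-]|].
    exact: subgroup1 (is_subgroup_generated _).
  rewrite set_nil image_set0; apply: generated_sub; last exact: sub0set.
  by apply: is_subgroup_image; exact/is_subgroupP.
have -> : f @` [set` c :: s] = f @` [set` s] `|` [set f c].
  apply/seteqP; split=> g.
    move=> [c' + <-]; rewrite /= in_cons => /orP[/eqP ->|c's]; first by right.
    by left; exists c'.
  move=> [[c' c's <-]|->]; last by exists c; rewrite //= mem_head.
  by exists c'; rewrite //= in_cons orbC [c' \in s]c's.
(* Evaluation is a right action because products compose from left to right. *)
apply: (isomorphic_to_wreath (act := fun x g => PLo_fun g x) _ _ _ (S_neq0 c)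
  (@S_wandering c)) => //.
- by move=> g h gh; exact: PLo_eq.
- by apply: IH; exact: path_sorted ss.
move=> _ [c' c's <-] x nSx; apply: contrapT => fx; apply: nSx; apply: f_S fx.
by move/(order_path_min (rev_trans lt_trans))/allP: ss; apply.
Qed.

Hypothesis f_inj : injective f.

Lemma finite_sorted_image X : finite_set X -> X `<=` range f ->
  exists2 s, sorted >%O s & X = f @` [set` s].
Proof.
move=> fX Xf; have : finite_set (f @^-1` X).
  by apply: finite_preimage fX => x y _ _; exact: f_inj.
move=> /finite_seqP[s0 s0E]; exists (rev (sort <=%O (undup s0))).
  by rewrite rev_sorted sort_lt_sorted undup_uniq.
apply/seteqP; split=> [g Xg|_ [c cs <-]].
  have [c _ cg] := Xf g Xg; exists c => //=.
  rewrite mem_rev mem_sort mem_undup.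
  by have : [set` s0] c by rewrite -s0E /preimage /= cg.
have : [set` s0] c by move: cs; rewrite /= mem_rev mem_sort mem_undup.
by rewrite -s0E.
Qed.

Lemma isomorphic_to_W_card n X :
  X `<=` range f -> (X #= `I_n)%card -> isomorphic_to (generated X) (W n).
Proof.
move=> Xf Xn; have [|s ss XE] := @finite_sorted_image X _ Xf; first by exists n.
(* [s] has no repetitions and [f] is injective, so [X] has as many elements as [s] has entries. *)
suff <- : size s = n by rewrite XE; exact: isomorphic_to_W.
have us : uniq s by rewrite -rev_uniq; apply: lt_sorted_uniq; rewrite rev_sorted.
apply/card_eq_II; apply: card_eq_trans Xn; apply: card_esym.
rewrite XE; apply: card_eq_trans (inj_card_eq _) _; first by move=> x y _ _; exact: f_inj.
have := finmap.card_fseq s; rewrite undup_id // => /card_eq_fsetP.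
by congr (_ #= _)%card; apply/seteqP; split=> x /=; rewrite inE.
Qed.

(** A finite subset already lies in the subgroup generated by finitely many [f c], which is
    isomorphic to some solvable [W n]. *)
Lemma locally_solvable_generated : locally_solvable (generated (range f)).
Proof.
move=> X fX /generated_finite[//|Y [fY Yf XY]].
have [s ss YE] := finite_sorted_image fY Yf.
have [phi [_ rphi]] := isomorphic_to_W ss.
apply: (@solvable_subgroup_le _ _ (generated Y)).
- exact: is_subgroup_generated.
- exact: is_subgroup_generated.
- by apply: generated_sub => //; exact: is_subgroup_generated.
by rewrite YE -rphi; apply: solvable_range; exact: solvable_W.
Qed.

End Chain.
End WanderingElements.

(** * Orbitals and the generating tower *)

Lemma orbital_unique (R : realType) (f : PLo R) A B :
  open_interval A -> Defs.support f = A -> orbital f B <-> B = A.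
Proof.
move=> oA fA; split=> [[oB Bf Bmax]|->].
  by apply/esym; apply: Bmax; rewrite -?fA //; rewrite fA.
split=> //; first by rewrite fA.
by move=> D _ AD Df; apply/seteqP; split=> //; rewrite -fA.
Qed.

Local Open Scope card_scope.

Theorem theorem4p1 (R : realType) (d : Order.disp_t) (C : orderType d)
    (C_countable : countable [set: C]) :
  exists (WC : set (PLo R)) (T : set (signed_orbital R)),
    [/\ is_subgroup WC, WC `<=` thompsonF R & locally_solvable WC] /\
    [/\ tower WC T, pure T, tower_order_isomorphic T C &
        generated (signatures T) = WC] /\
    forall (n : nat) (X : set (PLo R)),
      X `<=` signatures T -> X #= `I_n -> isomorphic_to (generated X) (W n).
Proof.
have [p [q [pq_dyadic pq pq_lt]]] := @countable_order_dyadic_gaps R d C C_countable.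
pose A c := [set x : unitI R | 2^-1 - q c < \val x < 2^-1 + q c].
pose S c := [set x : unitI R | 2^-1 - p c < \val x < 2^-1 + p c].
have half_dyadic : dyadic (2^-1 : R).
  by have := dyadic_half (@dyadic_int R 1); rewrite mulr1z div1r.
have /choice[f fE] c : exists f : PLo R, [/\ dyadicPL f,
    forall x, \val x <= \val (f x), Defs.support f = A c &
    forall x, 2^-1 - p c <= \val x -> 2^-1 + p c <= \val (f x)].
  have [dp dq] := pq_dyadic c; have [p0 pqc q1] := pq c.
  by apply: displacing_element; [exact: dyadicB|exact: dyadicD|lra..].
have S_neq0 c : S c !=set0.
  have [p0 _ _] := pq c.
  have [|x xE] := @unitI_exists R 2^-1; first by lra.
  by exists x; rewrite /S /= xE; lra.
have S_wandering c k x : S c x -> S c ((zpow (f c) k) x) -> k = 0.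
  by have [_ f_ge _ f_disp] := fE c; exact: displacing_wandering.
have AS c c' : (c < c')%O -> A c `<=` S c'.
  by move=> /pq_lt qp x; rewrite /A /S /=; lra.
have f_S c c' : (c < c')%O -> Defs.support (f c) `<=` S c'.
  by have [_ _ -> _] := fE c; exact: AS.
have nAA c c' : (c < c')%O -> ~ A c' `<=` A c.
  move=> cc' AA; have [p0 pqc q1] := pq c'; have := pq_lt _ _ cc'.
  (* This point separates the two supports: it is in [A c'] since [p c' < q c'], and outside [A c]
     since [q c < p c']. *)
  have [|x xE] := @unitI_exists R (2^-1 - p c'); first by lra.
  have /AA : A c' x by rewrite /A /= xE; lra.
  by rewrite /A /= xE; lra.
have AAE c c' : (c <= c')%O <-> A c `<=` A c'.
  split=> [|AA]; last by rewrite leNgt; apply/negP => /nAA.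
  rewrite le_eqVlt => /orP[/eqP -> //|/pq_lt qp x].
  by have [] := pq c'; rewrite /A /=; lra.
have A_inj : injective A.
  by move=> c c' AA; apply/le_anti; apply/andP; split; apply/AAE; rewrite AA.
(* The support of [f c] is [A c], which determines [c]. *)
have f_inj : injective f.
  move=> c c' ff; apply: A_inj.
  by have [_ _ <- _] := fE c; have [_ _ <- _] := fE c'; rewrite ff.
have A_itv c : open_interval (A c).
  have [p0 pqc q1] := pq c.
  have [|a aE] := @unitI_exists R (2^-1 - q c); first by lra.
  have [|b bE] := @unitI_exists R (2^-1 + q c); first by lra.
  by exists a, b; rewrite aE bE; split; first by lra.
have orbE c B : orbital (f c) B <-> B = A c.
  by apply: orbital_unique (A_itv c) _; have [] := fE c.
pose T := range (fun c => (A c, f c)).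
have sigT : signatures T = range f.
  apply/seteqP; split=> [_ [_ [c _ <-] <-]|_ [c _ <-]]; first by exists c.
  by exists (A c, f c) => //; exists c.
exists (generated (range f)), T; split; [split|split; [split|]].
- exact: is_subgroup_generated.
- apply: subset_trans (@dyadicPL_thompsonF R).
  apply: generated_sub; first exact: is_subgroup_dyadicPL.
  by move=> _ [c _ <-]; have [] := fE c.
- exact: locally_solvable_generated S_neq0 S_wandering f_S f_inj.
- split.
  + move=> _ [c _ <-] /=; split; first exact/orbE.
    by apply: sub_generated; exists c.
  + move=> _ _ [c _ <-] [c' _ <-] /=.
    by have [/AAE|/AAE] := orP (le_total c c'); [left|right].
  + by move=> _ _ [c _ <-] [c' _ <-] /= /A_inj ->.
- move=> _ [c _ <-]; exists (A c); split; first exact/orbE.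
  by move=> B /orbE.
- exists (fun c => (A c, f c)) => //.
  by split=> [c _|c c' _ _ [/A_inj]|_ [c _ <-]] //; exists c.
- by rewrite sigT.
move=> n X; rewrite sigT.
exact: isomorphic_to_W_card S_neq0 S_wandering f_S f_inj n X.
Qed.
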